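(* Let $\varphi=\frac12(\sqrt5+1)$ be the golden ratio. Then there exists a constant $P>(1-0.5847)^{32}\varphi$ such that in any model in $\mathcal{D}_{\ge 0.5847}(Q_6)$, the probability that the random spanning subgraph of $Q_6$ is connected is at least $P$.
   Context: $Q_6$ is the $6$-dimensional hypercube graph with vertex set $\{0,1\}^6$, two vertices being adjacent iff they differ in exactly one coordinate. A bond percolation model on a graph $G$ is a probability distribution on the spanning subgraphs of $G$; an edge is open if it is present in the random subgraph and closed otherwise. The model is 1-independent if, for any two disjoint sets of edges $S_1$, $S_2$ of $G$ such that no edge in $S_1$ shares a vertex with an edge in $S_2$, the states (open or closed) of the edges in $S_1$ are independent of the states of the edges in $S_2$. $\mathcal{D}_{\ge p}(G)$ is the class of 1-independent bond percolation models on $G$ in which each edge is open with probability at least $p$. *)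

(* Defs.v *)
From mathcomp Require Import all_boot all_order all_algebra.
From mathcomp Require Import reals.

Set Implicit Arguments.
Unset Strict Implicit.
Unset Printing Implicit Defensive.

Import Order.TTheory GRing.Theory Num.Theory.
Local Open Scope ring_scope.

Record sgraph := SGraph {
  vertex :> finType;
  adj : rel vertex;
  adj_sym : symmetric adj;
  adj_irr : irreflexive adj }.

Definition is_edge (G : sgraph) (A : {set G}) : bool :=
  [exists u, exists v, adj u v && (A == [set u; v])].

Definition edge (G : sgraph) := {A : {set G} | is_edge A}.

(* A spanning subgraph keeps every vertex of G, hence is given by its edges. *)
Definition spanning_subgraph (G : sgraph) := {set edge G}.

Definition sub_adj (G : sgraph) (H : spanning_subgraph G) : rel G :=
  fun u v => [exists a in H, val a == [set u; v]].

Definition connected (G : sgraph) (H : spanning_subgraph G) : bool :=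
  [forall u, forall v, connect (sub_adj H) u v].

Record percolation_model (R : realType) (G : sgraph) := PercolationModel {
  mass :> spanning_subgraph G -> R;
  mass_ge0 : forall H, 0 <= mass H;
  mass_sum1 : \sum_(H : spanning_subgraph G) mass H = 1 }.

Definition Pr (R : realType) (G : sgraph) (mu : percolation_model R G)
    (E : pred (spanning_subgraph G)) : R :=
  \sum_(H : spanning_subgraph G | E H) mu H.

Definition share_vertex (G : sgraph) (a b : edge G) : bool :=
  [exists x, (x \in val a) && (x \in val b)].

(* [H :&: S] records the states of the edges of [S], so an event determined   *)
(* by these states has the form [H :&: S \in A].                              *)
Definition one_independent (R : realType) (G : sgraph)
    (mu : percolation_model R G) : Prop :=
  forall S1 S2 : {set edge G},
    [disjoint S1 & S2] ->
    (forall a b, a \in S1 -> b \in S2 -> ~~ share_vertex a b) ->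
  forall A1 A2 : {set {set edge G}},
    Pr mu (fun H => (H :&: S1 \in A1) && (H :&: S2 \in A2)) =
    Pr mu (fun H => H :&: S1 \in A1) * Pr mu (fun H => H :&: S2 \in A2).

Definition D_ge (R : realType) (p : R) (G : sgraph)
    (mu : percolation_model R G) : Prop :=
  one_independent mu /\ forall a : edge G, p <= Pr mu (fun H => a \in H).

Definition cube_adj (n : nat) : rel {ffun 'I_n -> bool} :=
  fun u v => #|[set i | u i != v i]| == 1%N.

Lemma cube_adj_sym n : symmetric (@cube_adj n).
Proof.
move=> u v; rewrite /cube_adj; congr (_ == _); apply: eq_card => i.
by rewrite !inE eq_sym.
Qed.

Lemma cube_adj_irr n : irreflexive (@cube_adj n).
Proof.
move=> u; rewrite /cube_adj (_ : [set i | _] = set0) ?cards0 //.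
by apply/setP=> i; rewrite !inE eqxx.
Qed.

Definition hypercube (n : nat) : sgraph :=
  SGraph (@cube_adj_sym n) (@cube_adj_irr n).

Definition golden_ratio (R : realType) : R := 2^-1 * (Num.sqrt 5 + 1).

(* Main.v *)
(* Write q = 0.4153. A 1-independent law on Q_3 whose edges are closed with   *)
(* probability at most q is connected with probability at least 31/670, by    *)
(* linear programming: after thinning, every edge is closed with probability  *)
(* exactly q, and this makes the independence of an edge from the edges far   *)
(* from it a family of linear constraints, whose dual is solved explicitly.   *)
(* Now view Q_6 as Q_3 x Q_3. The 8 copies of Q_3 are independently connected *)
(* with probability at least 31/670 each. Conditionally on all of them being  *)
(* connected, contract them: the quotient is a random subgraph of Q_3 in      *)
(* which the state of an edge is still independent of the far edges, and an   *)
(* edge is closed with probability at most q^8 / (31/670)^2 < 827/2000 < q.   *)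
(* A second linear program shows that this quotient is connected with         *)
(* probability at least 19/400, so that P = (31/670)^8 (19/400).              *)

From Stdlib Require Import ZArith.
Require Import Defs.
From mathcomp Require Import all_boot all_order all_algebra.
From mathcomp Require Import reals.
From mathcomp Require Import zify ssrZ ring lra.

Set Implicit Arguments.
Unset Strict Implicit.
Unset Printing Implicit Defensive.

Import Order.TTheory GRing.Theory Num.Theory.
Local Open Scope ring_scope.

Local Delimit Scope Z_scope with coqZ.

(** Write f = 31/670 and s = 827/2000. Both linear programs are settled by weak duality: a table of
    weights yields an inequality valid for each of the 2^12 configurations of Q_3, checked by
    computation and integrated in [certified_bound]. This needs every edge to be closed with
    probability exactly r; [thinning_bound] relaxes it to at most r, since closing further edges at
    random can only hurt connectivity.

    These bounds are stated for positive functionals of arbitrary mass, so that conditioning on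
    connected blocks is just multiplication by an indicator. [block_conn_prob] treats one block and
    [quotient_conn_prob] the quotient, whose edges are closed with conditional probability at most
    q^8 / f^2 <= s; [blocks_connected] glues the two levels. The same estimate settles the final
    comparison: q^32 <= s^4 f^8, and s^4 times the golden ratio is below 19/400. *)

(** * Deciding connectivity of a configuration on Q_3 *)

Definition cube_edges : seq (nat * nat) :=
  [:: (0, 1); (0, 2); (0, 4); (1, 3); (1, 5); (2, 3);
      (2, 6); (3, 7); (4, 5); (4, 6); (5, 7); (6, 7)]%N.

Definition ends (e : nat) : nat * nat := nth (0, 0)%N cube_edges e.

Definition touches (e x : nat) : bool := (x == (ends e).1) || (x == (ends e).2).

Definition far (e i : nat) : bool :=
  ~~ touches e (ends i).1 && ~~ touches e (ends i).2.

Definition merge (m : seq nat) (uv : nat * nat) : seq nat :=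
  [seq if l == nth 0%N m uv.2 then nth 0%N m uv.1 else l | l <- m].

(** A naive union-find, kept on plain lists so that it evaluates quickly on all configurations. *)
Definition labels (L : seq (nat * nat)) : seq nat := foldl merge (iota 0 8) L.

Definition joined (L : seq (nat * nat)) : bool :=
  all (fun i => nth 0%N (labels L) i == nth 0%N (labels L) 0) (iota 0 8).

Definition open_ends (b : nat -> bool) : seq (nat * nat) :=
  [seq ends i | i <- iota 0 12 & b i].

Definition cube_conn (b : nat -> bool) : bool := joined (open_ends b).

Definition in_cube (uv : nat * nat) : bool := (uv.1 < 8)%N && (uv.2 < 8)%N.

Lemma ends_in_cube e : in_cube (ends e).
Proof. by do 12?[case: e => [//|e]]; rewrite /ends nth_default. Qed.

Lemma nth_merge m uv i : (i < size m)%N ->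
  nth 0%N (merge m uv) i =
  if nth 0%N m i == nth 0%N m uv.2 then nth 0%N m uv.1 else nth 0%N m i.
Proof. by move=> lt_im; rewrite (nth_map 0%N). Qed.

Lemma labels_sound (r : nat -> nat -> Prop) L :
    (forall x, r x x) -> (forall x y, r x y -> r y x) ->
    (forall x y z, r x y -> r y z -> r x z) ->
    all in_cube L -> (forall uv, uv \in L -> r uv.1 uv.2) ->
  size (labels L) = 8%N /\ forall i j, (i < 8)%N -> (j < 8)%N ->
    nth 0%N (labels L) i = nth 0%N (labels L) j -> r i j.
Proof.
move=> r_refl r_sym r_trans; rewrite /labels; elim/last_ind: L => [|L uv IHL].
  by move=> _ _; split=> // i j i8 j8; rewrite !nth_iota // !add0n => ->.
rewrite all_rcons => /andP[/andP[u8 v8] L8] rL.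
have [|sz IH] := IHL L8.
  by move=> e eL; apply: rL; rewrite mem_rcons inE eL orbT.
have ruv : r uv.1 uv.2 by apply: rL; rewrite mem_rcons inE eqxx.
rewrite foldl_rcons; split=> [|i j i8 j8]; first by rewrite size_map.
rewrite !nth_merge ?sz //.
case: eqP => [iv|_]; case: eqP => [jv|_].
- by move=> _; apply: IH => //; rewrite iv jv.
- move=> uj; apply: (r_trans _ _ _ (IH _ _ i8 v8 iv)).
  by apply: (r_trans _ _ _ (r_sym _ _ ruv)); apply: IH.
- move=> iu; apply: (r_trans _ _ _ _ (r_sym _ _ (IH _ _ j8 v8 jv))).
  by apply: (r_trans _ _ _ _ ruv); apply: IH.
- exact: IH.
Qed.

Lemma labels_complete L : all in_cube L -> size (labels L) = 8%N /\
  forall uv, uv \in L -> nth 0%N (labels L) uv.1 = nth 0%N (labels L) uv.2.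
Proof.
rewrite /labels; elim/last_ind: L => [//|L uv IHL].
rewrite all_rcons => /andP[/andP[u8 v8] L8]; have [sz IH] := IHL L8.
rewrite foldl_rcons; split=> [|e]; first by rewrite size_map.
rewrite mem_rcons inE => /orP[/eqP-> | eL].
  by rewrite !nth_merge ?sz // eqxx; case: ifP.
have /andP[e1 e2] := allP L8 _ eL.
by rewrite !nth_merge ?sz // (IH _ eL).
Qed.

Lemma open_ends_in_cube b : all in_cube (open_ends b).
Proof. by apply/allP=> uv /mapP[i _ ->]; apply: ends_in_cube. Qed.

(** The relation is arbitrary because three are used: reachability inside a block, reachability
    between blocks, and equality of labels. *)
Lemma cube_conn_sound (r : nat -> nat -> Prop) (b : nat -> bool) :
    (forall x, r x x) -> (forall x y, r x y -> r y x) ->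
    (forall x y z, r x y -> r y z -> r x z) ->
    (forall e, (e < 12)%N -> b e -> r (ends e).1 (ends e).2) ->
  cube_conn b -> forall i j, (i < 8)%N -> (j < 8)%N -> r i j.
Proof.
move=> r_refl r_sym r_trans rb /allP conn i j i8 j8.
have [|_ sound] := labels_sound r_refl r_sym r_trans (open_ends_in_cube b).
  by move=> uv /mapP[e]; rewrite mem_filter mem_iota => /andP[? ?] ->; apply: rb.
have to0 k : (k < 8)%N -> nth 0%N (labels (open_ends b)) k
    = nth 0%N (labels (open_ends b)) 0.
  by move=> k8; apply/eqP/conn; rewrite mem_iota.
by apply: sound => //; rewrite !to0.
Qed.

(** Equality of the labels of [b'] is an equivalence relation joining the ends of every edge open in
    [b], so soundness for [b] makes these labels all equal. *)
Lemma cube_conn_mono (b b' : nat -> bool) :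
  (forall i, b i -> b' i) -> cube_conn b -> cube_conn b'.
Proof.
move=> sub_bb'; set m := labels (open_ends b') => /(@cube_conn_sound
  (fun i j => nth 0%N m i = nth 0%N m j)) conn; apply/allP=> i.
rewrite mem_iota => i8; apply/eqP; apply: conn => // [x y z -> // | e e12 be].
have [_ comp] := labels_complete (open_ends_in_cube b').
by apply/comp/map_f; rewrite mem_filter sub_bb' // mem_iota.
Qed.

Lemma eq_in_cube_conn b b' :
  (forall i, (i < 12)%N -> b i = b' i) -> cube_conn b = cube_conn b'.
Proof.
move=> eq_b; congr joined; congr map.
by apply: eq_in_filter => i; rewrite mem_iota => /eq_b.
Qed.

(** * Dual certificates for the two linear programs *)

(* Entry [e] lists the edges far from [e], in the order in which an           *)
(* automorphism of the cube sending edge 0 to [e] permutes those of edge 0.   *)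
Definition far_edges : seq (seq nat) :=
  [:: [:: 5; 6; 7; 8; 9; 10; 11]; [:: 3; 4; 7; 9; 8; 11; 10]; [:: 4; 3; 10;
  6; 5; 11; 7]; [:: 1; 2; 6; 10; 8; 11; 9]; [:: 2; 1; 9; 7; 5; 11; 6]; [::
  0; 2; 4; 11; 9; 10; 8]; [:: 2; 0; 8; 7; 3; 10; 4]; [:: 4; 0; 8; 6; 1; 9;
  2]; [:: 0; 1; 3; 11; 6; 7; 5]; [:: 1; 0; 5; 10; 4; 7; 3]; [:: 3; 0; 5; 9;
  2; 6; 1]; [:: 5; 1; 3; 8; 2; 4; 0]].

Lemma far_edgesP e : (e < 12)%N ->
  all (fun i => (i < 12)%N && far e i) (nth [::] far_edges e).
Proof. by do 12?[case: e => [//|e]]. Qed.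

(** The linear program is invariant under the automorphisms of the cube, so a dual solution can be
    taken invariant too, and one table of 2^7 values serves all twelve edges. The first far edge
    gives the lowest bit of the index. *)
Definition weight (tab : seq Z) (e : nat) (b : nat -> bool) : Z :=
  nth 0%coqZ tab
    (foldr (fun i k => (b i + k.*2)%N) 0%N (nth [::] far_edges e)).

Definition dual_term (rn rd : Z) tab (b : nat -> bool) (e : nat) :=
  ((if b e then - rn else rd - rn) * weight tab e b)%coqZ.

(* Weak duality, cleared of denominators: with r = rn / rd, c = cn / cd and   *)
(* phi_e = weight / K it reads c <= 1_conn + sum_e (1_{e closed} - r) phi_e,  *)
(* and the sum has mean 0 as phi_e only looks at edges far from e.            *)
Definition certified (rn rd cn cd K : Z) (tab : seq Z)
    (s : bitseq) : bool :=
  let b := nth false s in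
  (cn * (K * rd) <=? cd * ((if cube_conn b then K * rd else 0) +
    foldr Z.add 0 [seq dual_term rn rd tab b e | e <- iota 0 12]))%coqZ.

Fixpoint all_bits (n : nat) (test : pred bitseq) : bool :=
  if n is n'.+1 then
    all_bits n' (fun s => test (true :: s)) &&
    all_bits n' (fun s => test (false :: s))
  else test [::].

Lemma all_bitsP n (test : pred bitseq) s :
  all_bits n test -> size s = n -> test s.
Proof.
elim: n test s => [|n IHn] test [|x s] //= /andP[tT tF] [sz].
by case: x; [apply: (IHn _ _ tT) | apply: (IHn _ _ tF)].
Qed.

(* Optimal solutions, scaled by 25079 and 1002 and rounded, of the linear     *)
(* program dual to minimising the probability that the cube is connected, for *)
(* closed probabilities 4153/10000 and 827/2000. The bits of an index are the *)
(* states of the edges listed in [far_edges].                                 *)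
Definition weights1 : seq Z :=
  [:: 3092; -7131; -6317; -11878; -6317; -11878; 13432; 14398; -7131; 90194;
  -30388; 37581; -30388; 37581; -28159; 27864; -6317; -30388; -4059; -21558;
  -18508; -20677; 13047; 7917; -11878; 37581; -21558; 5825; -20677; 22037;
  -13851; 23538; -6317; -30388; -18508; -20677; -4059; -21558; 13047; 7917;
  -11878; 37581; -20677; 22037; -21558; 5825; -13851; 23538; 13432; -28159;
  13047; -13851; 13047; -13851; 8761; 2242; 14398; 27864; 7917; 23538; 7917;
  23538; 2242; 13279; 76233; -996; 36325; -6923; 36325; -6923; 52189; 0;
  -996; 36173; -17613; 11190; -17613; 11190; 4922; 5818; 36325; -17613;
  30559; -14585; 7735; -13338; 30781; 0; -6923; 11190; -14585; 0; -13338;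
  2514; 4729; 7968; 36325; -17613; 7735; -13338; 30559; -14585; 30781; 0;
  -6923; 11190; -13338; 2514; -14585; 0; 4729; 7968; 52189; 4922; 30781;
  4729; 30781; 4729; 0; 0; 0; 5818; 0; 7968; 0; 7968; 0; 4799]%coqZ.

Definition weights2 : seq Z :=
  [:: 142; -290; -256; -485; -256; -485; 539; 576; -290; 3649; -1235; 1512;
  -1235; 1512; -1141; 1120; -256; -1235; -168; -874; -752; -838; 527; 318;
  -485; 1512; -874; 233; -838; 890; -564; 957; -256; -1235; -752; -838;
  -168; -874; 527; 318; -485; 1512; -838; 890; -874; 233; -564; 957; 539;
  -1141; 527; -564; 527; -564; 350; 89; 576; 1120; 318; 957; 318; 957; 89;
  534; 3099; -31; 1463; -273; 1463; -273; 2112; 0; -31; 1481; -712; 455;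
  -712; 455; 202; 233; 1463; -712; 1242; -583; 311; -549; 1253; 0; -273;
  455; -583; 0; -549; 94; 184; 319; 1463; -712; 311; -549; 1242; -583; 1253;
  0; -273; 455; -549; 94; -583; 0; 184; 319; 2112; 202; 1253; 184; 1253;
  184; 0; 0; 0; 233; 0; 319; 0; 319; 0; 192]%coqZ.

Lemma weights1_certified :
  all_bits 12 (certified (Z.of_nat 4153) (Z.of_nat 10000) (Z.of_nat 31)
    (Z.of_nat 670) 25079 weights1).
Proof. by vm_compute. Qed.

Lemma weights2_certified :
  all_bits 12 (certified (Z.of_nat 827) (Z.of_nat 2000) (Z.of_nat 19)
    (Z.of_nat 400) 1002 weights2).
Proof. by vm_compute. Qed.

Lemma eq_in_weight tab e (b b' : nat -> bool) : (e < 12)%N ->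
    (forall i, (i < 12)%N -> far e i -> b i = b' i) ->
  weight tab e b = weight tab e b'.
Proof.
move=> e12 eq_b; congr nth; move: (far_edgesP e12).
by elim: (nth _ _ e) => //= i s IHs /andP[/andP[? ?] /IHs ->]; rewrite eq_b.
Qed.

Lemma eq_in_certified rn rd cn cd K tab (b : nat -> bool) :
    all_bits 12 (certified rn rd cn cd K tab) ->
  (cn * (K * rd) <= cd * ((if cube_conn b then K * rd else 0) +
    foldr Z.add 0 [seq dual_term rn rd tab b e | e <- iota 0 12]))%coqZ.
Proof.
move=> /(all_bitsP (s := mkseq b 12)); rewrite size_mkseq => /(_ erefl).
have eq_b i : (i < 12)%N -> nth false (mkseq b 12) i = b i by apply: nth_mkseq.
rewrite /certified (eq_in_cube_conn eq_b).
rewrite (_ : map _ _ = [seq dual_term rn rd tab b e | e <- iota 0 12]).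
  by move/Z.leb_le.
apply/eq_in_map => e; rewrite mem_iota => /= e12.
by rewrite /dual_term eq_b // (eq_in_weight _ (b' := b)) // => i /eq_b.
Qed.

(** * Thinning down to exact closing probabilities *)

Section Thinning.
Variable R : realType.
Implicit Types (E : ((nat -> bool) -> R) -> R) (F G phi : (nat -> bool) -> R).

(* A positive linear functional: integration against a finite measure on      *)
(* configurations, not necessarily of mass 1.                                 *)
Record positive_functional E : Prop := PositiveFunctional {
  functionalD : forall F G, E (fun b => F b + G b) = E F + E G;
  functionalZ : forall a F, E (fun b => a * F b) = a * E F;
  functional_le : forall F G, (forall b, F b <= G b) -> E F <= E G }.

Definition depends_far (e : nat) phi : Prop := forall b b' : nat -> bool,
  (forall i, (i < 12)%N -> far e i -> b i = b' i) -> phi b = phi b'.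

(* Edge [e] is closed with probability [r], independently of the edges that   *)
(* share no vertex with it.                                                   *)
Definition closed_indep E (e : nat) (r : R) : Prop := forall phi,
  depends_far e phi -> E (fun b => ((~~ b e)%:R - r) * phi b) = 0.

Definition connF (b : nat -> bool) : R := (cube_conn b)%:R.

Lemma eq_functional E F G : positive_functional E -> F =1 G -> E F = E G.
Proof.
move=> hE FG; apply/eqP; rewrite eq_le.
by rewrite !(functional_le hE) // => b; rewrite FG.
Qed.

Lemma functional_sum E (s : seq nat) (F : nat -> (nat -> bool) -> R) :
  positive_functional E ->
  E (fun b => \sum_(e <- s) F e b) = \sum_(e <- s) E (F e).
Proof.
move=> hE; elim: s => [|e s IHs].
  rewrite big_nil -[RHS](mul0r (E (fun=> 0))) -(functionalZ hE).
  by apply: (eq_functional hE) => b; rewrite big_nil mul0r.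
rewrite big_cons -IHs -(functionalD hE).
by apply: (eq_functional hE) => b; rewrite big_cons.
Qed.

Definition close (e : nat) (b : nat -> bool) : nat -> bool :=
  fun i => b i && (i != e).

(** The mean of [F] after edge [e], if open, is closed by an independent coin of bias [t]. *)
Definition thin_fun (e : nat) (t : R) F : (nat -> bool) -> R :=
  fun b => if b e then (1 - t) * F b + t * F (close e b) else F b.

Definition thin (e : nat) (t : R) E : ((nat -> bool) -> R) -> R :=
  fun F => E (thin_fun e t F).

Lemma thin_functional e t E : 0 <= t <= 1 ->
  positive_functional E -> positive_functional (thin e t E).
Proof.
move=> /andP[t0 t1] hE; split=> [F G|a F|F G FG].
- rewrite /thin -(functionalD hE); apply: (eq_functional hE) => b.
  by rewrite /thin_fun; case: ifP => _ //; ring.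
- rewrite /thin -(functionalZ hE); apply: (eq_functional hE) => b.
  by rewrite /thin_fun; case: ifP => _ //; ring.
- apply: (functional_le hE) => b; rewrite /thin_fun; case: ifP => // _.
  by rewrite lerD ?ler_wpM2l // subr_ge0.
Qed.

Lemma thin_mass e t E : positive_functional E ->
  thin e t E (fun=> 1) = E (fun=> 1).
Proof.
move=> hE; apply: (eq_functional hE) => b.
by rewrite /thin_fun; case: ifP => _ //; ring.
Qed.

Lemma thin_conn e t E : 0 <= t -> positive_functional E ->
  thin e t E connF <= E connF.
Proof.
move=> t0 hE; apply: (functional_le hE) => b; rewrite /thin_fun.
case: ifP => // _; have : connF (close e b) <= connF b.
  rewrite ler_nat; case: (boolP (cube_conn (close e b))) => // closed_conn.
  by rewrite (cube_conn_mono _ closed_conn) // => i /andP[].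
by move=> /(ler_wpM2l t0); lra.
Qed.

Lemma far_neq e i : far e i -> i != e.
Proof. by apply: contraTneq => ->; rewrite /far /touches eqxx. Qed.

(** The bias solves r' + (1 - r') t = r. Thinning multiplies the centred indicator of closure, on
    average, by the constant [a]. *)
Lemma thin_closed_indep_same e E r r' : r' < 1 -> positive_functional E ->
  closed_indep E e r' -> closed_indep (thin e ((r - r') / (1 - r')) E) e r.
Proof.
move=> r'1 hE ind phi dphi; set a := (1 - r) / (1 - r').
have r'n1 : 1 - r' != 0 by rewrite subr_eq0 gt_eqF.
rewrite -[RHS](mulr0 a) -(ind _ dphi) -(functionalZ hE).
apply: (eq_functional hE) => b; rewrite /thin_fun /a.
rewrite (dphi (close e b) b); last first.
  by move=> i _ /far_neq ie; rewrite /close ie andbT.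
rewrite /close eqxx andbF; case: (b e) => /=; by field.
Qed.

(** The thinned [phi] is again a test function for [e]: if [e0] is far from [e], it may look at
    [e0]; otherwise [phi] ignores [e0] and thinning leaves it unchanged. *)
Lemma thin_closed_indep_other e0 t e E r : e != e0 -> positive_functional E ->
  closed_indep E e r -> closed_indep (thin e0 t E) e r.
Proof.
move=> e_e0 hE ind phi dphi.
rewrite -(ind (thin_fun e0 t phi)) => [|b b' eq_b].
  apply: (eq_functional hE) => b; rewrite /thin_fun /close e_e0 andbT.
  by case: (b e0); ring.
have eq_close : phi (close e0 b) = phi (close e0 b').
  by apply: dphi => i i12 ei; rewrite /close (eq_b i).
rewrite /thin_fun (dphi b b') // eq_close.
have [efar|enotfar] := boolP ((e0 < 12)%N && far e e0).
  by case/andP: efar => e012 /(eq_b _ e012) ->.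
have -> : phi (close e0 b') = phi b'.
  apply: dphi => i i12 ei; rewrite /close; case: eqP => [ie0|_]; last first.
    by rewrite andbT.
  by rewrite -ie0 i12 ei in enotfar.
by case: (b e0); case: (b' e0) => //; ring.
Qed.

Lemma thinning_bound (r c : R) : r < 1 ->
    (forall E, positive_functional E ->
       (forall e, (e < 12)%N -> closed_indep E e r) ->
       c * E (fun=> 1) <= E connF) ->
  forall E, positive_functional E ->
    (forall e, (e < 12)%N -> exists2 r', r' <= r & closed_indep E e r') ->
  c * E (fun=> 1) <= E connF.
Proof.
move=> r1 base E hE indE.
(* Edges from [n] on already have closing probability exactly [r]; thinning edge [n] takes the case
   n + 1 to the case n. *)
suff bound n : (n <= 12)%N -> forall E, positive_functional E ->
    (forall e, (e < n)%N -> exists2 r', r' <= r & closed_indep E e r') ->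
    (forall e, (n <= e < 12)%N -> closed_indep E e r) ->
    c * E (fun=> 1) <= E connF.
  by apply: (bound 12) => // e /andP[/leq_ltn_trans h /h]; rewrite ltnn.
elim: n => [|n IHn] n12 {}E {}hE {}indE indr; first exact: base.
have [r' r'r indn] := indE n (leqnn _).
have r'1 : r' < 1 by apply: le_lt_trans r1.
have t0 : 0 <= (r - r') / (1 - r') by rewrite divr_ge0 // subr_ge0 // ltW.
have t1 : (r - r') / (1 - r') <= 1.
  by rewrite ler_pdivrMr ?subr_gt0 // mul1r lerD2r ltW.
set t := _ / _ in t0 t1.
apply: le_trans (thin_conn n t0 hE); rewrite -(thin_mass n t hE).
apply: IHn => [|||]; first exact: ltnW.
- by apply: thin_functional => //; rewrite t0.
- move=> e en; have [r'' ? ?] := indE e (ltnW en).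
  by exists r'' => //; apply: thin_closed_indep_other => //; rewrite ltn_eqF.
- move=> e /andP[]; rewrite leq_eqVlt => /orP[/eqP<- _|ne e12].
    exact: thin_closed_indep_same.
  by apply: thin_closed_indep_other; rewrite ?gtn_eqF //; apply/indr/andP.
Qed.

(** * Weak duality over the reals *)

Definition ZR (z : Z) : R := (int_of_Z z)%:~R.

Lemma ZR_M x y : ZR (x * y)%coqZ = ZR x * ZR y.
Proof. by rewrite /ZR -intrM; congr _%:~R; lia. Qed.

Lemma ZR_D x y : ZR (x + y)%coqZ = ZR x + ZR y.
Proof. by rewrite /ZR -intrD; congr _%:~R; lia. Qed.

Lemma ZR_N x : ZR (- x)%coqZ = - ZR x.
Proof. by rewrite /ZR -rmorphN; congr _%:~R; lia. Qed.

Lemma ZR_le x y : (x <= y)%coqZ -> ZR x <= ZR y.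
Proof. by move=> le_xy; rewrite ler_int; lia. Qed.

Lemma ZR_sum s : ZR (foldr Z.add 0%coqZ s) = \sum_(z <- s) ZR z.
Proof.
by elim: s => [|z s IHs]; rewrite ?big_nil // big_cons -IHs -ZR_D.
Qed.

Lemma ZR_nat n : ZR (Z.of_nat n) = n%:R.
Proof. by rewrite /ZR pmulrn; congr _%:~R; lia. Qed.

Lemma certified_bound (rn rd cn cd : nat) (K : Z) tab :
    all_bits 12 (certified (Z.of_nat rn) (Z.of_nat rd) (Z.of_nat cn)
      (Z.of_nat cd) K tab) ->
    (0 < K)%coqZ -> (0 < rd)%N -> (0 < cd)%N ->
  forall E, positive_functional E ->
    (forall e, (e < 12)%N -> closed_indep E e (rn%:R / rd%:R)) ->
  cn%:R / cd%:R * E (fun=> 1) <= E connF.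
Proof.
move=> cert K0 rd0 cd0 E hE; set r := _ / _; set c := _ / _ => ind.
have {}K0 : 0 < ZR K by rewrite ltr0z; lia.
have rdP : 0 < rd%:R :> R by rewrite ltr0n.
have cdP : 0 < cd%:R :> R by rewrite ltr0n.
have er : r * rd%:R = rn%:R by rewrite divfK ?gt_eqF.
have ec : c * cd%:R = cn%:R by rewrite divfK ?gt_eqF.
pose phi e b := ZR (weight tab e b) / ZR K.
have pointwise b :
    c * 1 <= connF b + \sum_(e <- iota 0 12) ((~~ b e)%:R - r) * phi e b.
  (* Multiplying by this factor clears all denominators and leaves the certified integer
     inequality. *)
  have KR0 : 0 < cd%:R * (ZR K * rd%:R) by rewrite !mulr_gt0.
  rewrite -(ler_pM2l KR0).
  have := ZR_le (@eq_in_certified _ _ _ _ _ _ b cert).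
  rewrite 3!ZR_M ZR_D ZR_sum big_map !ZR_nat -ec.
  have -> : ZR (if cube_conn b then (K * Z.of_nat rd)%coqZ else 0%coqZ) =
      ZR K * rd%:R * connF b.
    by rewrite /connF; case: ifP; rewrite ?ZR_M ?ZR_nat ?mulr1 ?mulr0.
  have -> : \sum_(e <- iota 0 12) 
      ZR (dual_term (Z.of_nat rn) (Z.of_nat rd) tab b e) =
      ZR K * rd%:R * \sum_(e <- iota 0 12) ((~~ b e)%:R - r) * phi e b.
    rewrite mulr_sumr; apply: eq_bigr => e _; rewrite /dual_term ZR_M /phi.
    have Kn0 : ZR K != 0 by rewrite gt_eqF.
    by case: (b e); rewrite ?(ZR_N, ZR_D) !ZR_nat -er /=; field.
  by rewrite mulr1 mulrDr; lra.
rewrite -(functionalZ hE).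
apply: le_trans (functional_le hE pointwise) _.
rewrite (functionalD hE) functional_sum // big_seq big1 ?addr0 // => e.
rewrite mem_iota => /= e12; apply: ind => // b b' eq_b.
by rewrite /phi (eq_in_weight tab e12 eq_b).
Qed.

End Thinning.

(** * Independence of functions living on disjoint vertex sets *)

Section Independence.
Variables (R : realType) (G : sgraph) (mu : percolation_model R G).
Implicit Types (f g : spanning_subgraph G -> R) (V W : {set G}).
Implicit Types (H : spanning_subgraph G).

Definition Ex f : R := \sum_H mu H * f H.

Lemma ExD f g : Ex (fun H => f H + g H) = Ex f + Ex g.
Proof. by rewrite -big_split; apply: eq_bigr => H _; rewrite mulrDr. Qed.

Lemma ExZ a f : Ex (fun H => a * f H) = a * Ex f.
Proof. by rewrite mulr_sumr; apply: eq_bigr => H _; rewrite mulrCA. Qed.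

Lemma Ex_le f g : (forall H, f H <= g H) -> Ex f <= Ex g.
Proof. by move=> fg; apply: ler_sum => H _; rewrite ler_wpM2l ?mass_ge0. Qed.

Lemma eq_Ex f g : f =1 g -> Ex f = Ex g.
Proof. by move=> fg; apply: eq_bigr => H _; rewrite fg. Qed.

Lemma Ex_cst a : Ex (fun=> a) = a.
Proof. by rewrite /Ex -mulr_suml mass_sum1 mul1r. Qed.

Lemma Ex_Pr (A : pred (spanning_subgraph G)) :
  Ex (fun H => (A H)%:R) = Pr mu A.
Proof.
by rewrite /Pr big_mkcond; apply: eq_bigr => H _; rewrite -mulrb mulr_natr.
Qed.

Definition agree V H H' : Prop :=
  forall a : edge G, val a \subset V -> (a \in H) = (a \in H').

Definition depends V f : Prop := forall H H', agree V H H' -> f H = f H'.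

Lemma dependsS V W f : V \subset W -> depends V f -> depends W f.
Proof.
move=> VW df H H' HH'; apply: df => a aV; apply: HH'; exact: subset_trans VW.
Qed.

Lemma depends_mul V f g :
  depends V f -> depends V g -> depends V (fun H => f H * g H).
Proof. by move=> df dg H H' HH'; rewrite (df _ _ HH') (dg _ _ HH'). Qed.

Lemma depends_prod V (n : nat) (P : pred nat)
    (f : nat -> spanning_subgraph G -> R) :
    (forall i, (i < n)%N -> P i -> depends V (f i)) ->
  depends V (fun H => \prod_(i < n | P i) f i H).
Proof.
by move=> df H H' HH'; apply: eq_bigr => i Pi; apply: (df _ _ Pi _ _ HH').
Qed.

Lemma sub_adj_agree V H H' u v :
  u \in V -> v \in V -> agree V H H' -> sub_adj H u v = sub_adj H' u v.
Proof.
move=> uV vV HH'; apply: eq_existsb => a.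
case: (val a =P [set u; v]) => [av|]; rewrite ?andbF // !andbT.
by apply: HH'; rewrite av subUset !sub1set uV.
Qed.

Lemma sub_adj_sym H : symmetric (sub_adj H).
Proof. by move=> u v; apply: eq_existsb => a; rewrite setUC. Qed.

Lemma closed_Pr p u v : D_ge p mu -> adj u v ->
  Ex (fun H => (~~ sub_adj H u v)%:R) <= 1 - p.
Proof.
move=> [_ open_p] uv.
have uvE : is_edge [set u; v].
  by apply/existsP; exists u; apply/existsP; exists v; rewrite uv /=.
pose a : edge G := exist (fun A => is_true (is_edge A)) _ uvE.
have openE H : sub_adj H u v = (a \in H).
  apply/existsP/idP => [[b /andP[bH /eqP bE]]|aH]; last first.
    by exists a; rewrite aH /=.
  by rewrite (_ : a = b) //; apply: val_inj.
rewrite (eq_Ex (g := fun H => 1 + -1 * (a \in H)%:R)); last first.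
  by move=> H; rewrite openE; case: (a \in H); rewrite /=; ring.
by rewrite ExD ExZ Ex_cst Ex_Pr; have := open_p a; lra.
Qed.

(** Edges inside [V] share no vertex with edges inside [W]. Summing over the traces of the subgraph
    on these two edge sets reduces the claim to events fixing one trace each. *)
Lemma Ex_indep V W f g : one_independent mu -> [disjoint V & W] ->
  depends V f -> depends W g -> Ex (fun H => f H * g H) = Ex f * Ex g.
Proof.
move=> ind VW df dg.
pose S (U : {set G}) : {set edge G} := [set a : edge G | val a \subset U].
have ftrace U H : agree U H (H :&: S U) by move=> a aU; rewrite !inE aU andbT.
have ExE U h : depends U h ->
    Ex h = \sum_K h K * Pr mu (fun H => H :&: S U \in [set K]).
  move=> dh; rewrite /Ex (partition_big (fun H => H :&: S U) predT) //=.
  apply: eq_bigr => K _; rewrite /Pr mulr_sumr.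
  apply: eq_big => [H|H /eqP<-]; first by rewrite inE.
  by rewrite mulrC; congr (_ * _); apply/dh/ftrace.
have no_common x : x \in V -> x \in W -> False.
  by move=> xV xW; move/pred0P: VW => /(_ x); rewrite /= xV xW.
have disjS : [disjoint S V & S W].
  apply/pred0P => a /=; apply/negP; rewrite !inE => /andP[aV aW].
  have /existsP[u /existsP[v /andP[_ /eqP av]]] := valP a.
  have ua : u \in val a by rewrite av !inE eqxx.
  exact: no_common (subsetP aV _ ua) (subsetP aW _ ua).
have farS a b : a \in S V -> b \in S W -> ~~ share_vertex a b.
  rewrite !inE => aV bW; apply/existsP => -[x /andP[xa xb]].
  exact: no_common (subsetP aV _ xa) (subsetP bW _ xb).
rewrite (ExE _ _ df) (ExE _ _ dg) big_distrlr /= pair_big /=.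
rewrite /Ex (partition_big (fun H => (H :&: S V, H :&: S W)) predT) //=.
apply: eq_bigr => -[K L] _ /=.
rewrite mulrACA -(ind _ _ disjS farS [set K] [set L]) /Pr mulr_sumr.
apply: eq_big => [H|H]; first by rewrite !inE xpair_eqE.
rewrite xpair_eqE => /andP[/eqP<- /eqP<-]; rewrite mulrC.
by rewrite (df _ _ (ftrace _ _)) (dg _ _ (ftrace _ _)).
Qed.

(** The fibres of [key] are disjoint vertex sets. With [hi] as key they separate the blocks, with
    [lo] the parallel edges between two blocks. *)
Lemma Ex_prod (key : G -> nat) (n : nat) (f : nat -> spanning_subgraph G -> R) :
    one_independent mu ->
    (forall i, (i < n)%N -> depends [set v | key v == i] (f i)) ->
  Ex (fun H => \prod_(i < n) f i H) = \prod_(i < n) Ex (f i).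
Proof.
move=> ind; elim: n => [|n IHn] df.
  by rewrite big_ord0 -[RHS]Ex_cst; apply: eq_Ex => H; rewrite big_ord0.
rewrite big_ord_recr /= -IHn => [|i lt_in]; last exact/df/ltnW.
rewrite -(@Ex_indep [set v | (key v < n)%N] [set v | key v == n]) //.
- by apply: eq_Ex => H; rewrite big_ord_recr.
- apply/pred0P => v /=; rewrite !inE.
  by case: eqP => [->|_]; rewrite ?ltnn ?andbF.
- apply: (@depends_prod _ n predT) => i lt_in _.
  apply: dependsS (df i (ltnW lt_in)).
  by apply/subsetP => v; rewrite !inE => /eqP->.
- exact: df.
Qed.

(** The weight [B] is 1 for a single block, and the indicator that all blocks are connected for the
    quotient. *)
Lemma Ex_functional (B : spanning_subgraph G -> R)
    (b : spanning_subgraph G -> nat -> bool) :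
  (forall H, 0 <= B H) ->
  positive_functional (fun F => Ex (fun H => B H * F (b H))).
Proof.
move=> B0; split=> [F F'|a F|F F' FF'].
- by rewrite -ExD; apply: eq_Ex => H; rewrite mulrDr.
- by rewrite -ExZ; apply: eq_Ex => H; rewrite mulrCA.
- by apply: Ex_le => H; rewrite ler_wpM2l.
Qed.

End Independence.

(** * Q_6 as a product of two copies of Q_3 *)

Section CubeOfCubes.

Local Notation Q6 := (hypercube 6).
Implicit Types (v w : Q6) (H : spanning_subgraph Q6).

Definition bit (x i : nat) : bool := odd (x %/ 2 ^ i).

(* Q_6 is the product of two copies of Q_3; [x] encodes the first three       *)
(* coordinates in binary and [y] the last three.                              *)
Definition vtx (x y : nat) : Q6 :=
  [ffun i : 'I_6 => if (i < 3)%N then bit x i else bit y (i - 3)].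

Definition hi (v : Q6) : nat :=
  (v (inord 0) + (v (inord 1)).*2 + (v (inord 2)).*2.*2)%N.

Definition lo (v : Q6) : nat :=
  (v (inord 3) + (v (inord 4)).*2 + (v (inord 5)).*2.*2)%N.

Lemma vtx_hi x y : (x < 8)%N -> hi (vtx x y) = x.
Proof. by rewrite /hi !ffunE !inordK //; do 8?[case: x => [//|x]]. Qed.

Lemma vtx_lo x y : (y < 8)%N -> lo (vtx x y) = y.
Proof. by rewrite /lo !ffunE !inordK //; do 8?[case: y => [//|y]]. Qed.

Lemma hi_lt8 v : (hi v < 8)%N.
Proof. by rewrite /hi; do 3!case: (v _). Qed.

Lemma lo_lt8 v : (lo v < 8)%N.
Proof. by rewrite /lo; do 3!case: (v _). Qed.

Lemma vtxK v : vtx (hi v) (lo v) = v.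
Proof.
apply/ffunP => i; rewrite ffunE /hi /lo -[in RHS](inord_val i).
case: i => i /= i6; do 6?[case: i i6 => [_|i i6]] => //=;
  by do 3!case: (v _).
Qed.

Lemma ends_one_bit e : (e < 12)%N ->
  has (fun d =>
    all (fun i => (bit (ends e).1 i != bit (ends e).2 i) == (i == d))
      (iota 0 3)) (iota 0 3).
Proof. by do 12?[case: e => [//|e]]. Qed.

Lemma adj_diff1 v w (j : 'I_6) :
  (forall i, (v i != w i) = (i == j)) -> @adj Q6 v w.
Proof.
move=> vw; rewrite /= /cube_adj (_ : [set _ | _] = [set j]) ?cards1 //.
by apply/setP => i; rewrite !inE vw.
Qed.

Lemma adj_lo x e : (e < 12)%N -> @adj Q6 (vtx x (ends e).1) (vtx x (ends e).2).
Proof.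
move=> /ends_one_bit /hasP[d]; rewrite mem_iota => /andP[_ d3] /allP diff.
(* Direction [d] of the second factor is coordinate 3 + d of Q_6. *)
apply: (@adj_diff1 _ _ (inord (3 + d))) => i; rewrite !ffunE.
rewrite -val_eqE /= inordK; last by rewrite (@ltn_add2l 3 d 3).
case: ltnP => i3; first by rewrite eqxx; apply/esym/negbTE; lia.
rewrite (eqP (diff (i - 3)%N _)); first lia.
by rewrite mem_iota; have := ltn_ord i; lia.
Qed.

Lemma adj_hi y e : (e < 12)%N -> @adj Q6 (vtx (ends e).1 y) (vtx (ends e).2 y).
Proof.
move=> /ends_one_bit /hasP[d]; rewrite mem_iota => /andP[_ d3] /allP diff.
apply: (@adj_diff1 _ _ (inord d)) => i; rewrite !ffunE.
rewrite -val_eqE /= inordK; last exact: leq_trans d3 _.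
case: ltnP => i3; first by rewrite (eqP (diff i _)) ?mem_iota.
by rewrite eqxx; apply/esym/negbTE; lia.
Qed.

Definition block_config x H (e : nat) : bool :=
  sub_adj H (vtx x (ends e).1) (vtx x (ends e).2).

Definition block_conn x H : bool := cube_conn (block_config x H).

Definition quotient_config H (e : nat) : bool :=
  has (fun y => sub_adj H (vtx (ends e).1 y) (vtx (ends e).2 y)) (iota 0 8).

(** The vertices [vtx x 0] represent the blocks; an open edge between two blocks, at any height [y],
    links their representatives after a walk inside each block. *)
Lemma blocks_connected H : (forall x, (x < 8)%N -> block_conn x H) ->
  cube_conn (quotient_config H) -> connected H.
Proof.
move=> blocks quotient; pose r := connect (sub_adj H).
have r_sym : symmetric r by apply: sym_connect_sym; apply: sub_adj_sym.
have r_trans : transitive r by apply: connect_trans.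
have r_block x y y' : (x < 8)%N -> (y < 8)%N -> (y' < 8)%N ->
    r (vtx x y) (vtx x y').
  move=> x8; move: y y'.
  apply: cube_conn_sound (blocks x x8) => [y|y y'|y y' y''|e _].
  - exact: connect0.
  - by rewrite r_sym.
  - exact: r_trans.
  - exact: connect1.
have r_hi x x' : (x < 8)%N -> (x' < 8)%N -> r (vtx x 0) (vtx x' 0).
  move: x x'; apply: cube_conn_sound quotient => [x|x x'|x x' x''|e _].
  - exact: connect0.
  - by rewrite r_sym.
  - exact: r_trans.
  - case/hasP => y; rewrite mem_iota => /= y8 open_y.
    have /andP[u8 v8] := ends_in_cube e.
    apply: (r_trans (vtx (ends e).1 y)); first exact: r_block.
    apply: (r_trans (vtx (ends e).2 y)); first exact: connect1.
    exact: r_block.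
apply/forallP => v; apply/forallP => w; rewrite -/r -(vtxK v) -(vtxK w).
apply: (r_trans (vtx (hi v) 0)).
  by apply: r_block; rewrite ?hi_lt8 ?lo_lt8.
apply: (r_trans (vtx (hi w) 0)); first by apply: r_hi; rewrite hi_lt8.
by apply: r_block; rewrite ?hi_lt8 ?lo_lt8.
Qed.

(** * Probability bounds for the blocks and for the quotient *)

Variables (R : realType) (mu : percolation_model R Q6).
Hypothesis mu_D : D_ge (5847 / 10000) mu.

Let indep : one_independent mu. Proof. by case: mu_D. Qed.

Lemma closed_prob v w : @adj Q6 v w ->
  Ex mu (fun H => (~~ sub_adj H v w)%:R) <= 4153 / 10000.
Proof.
have pE : 1 - 5847 / 10000 <= 4153 / 10000 :> R by lra.
by move=> /(closed_Pr mu_D)/le_trans; apply.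
Qed.

Lemma cube_bound1 E : positive_functional E ->
    (forall e, (e < 12)%N -> @closed_indep R E e (4153 / 10000)) ->
  31 / 670 * E (fun=> 1) <= E (@connF R).
Proof.
by move=> hE; apply: (certified_bound weights1_certified erefl isT isT hE).
Qed.

Lemma cube_bound2 E : positive_functional E ->
    (forall e, (e < 12)%N -> @closed_indep R E e (827 / 2000)) ->
  19 / 400 * E (fun=> 1) <= E (@connF R).
Proof.
by move=> hE; apply: (certified_bound weights2_certified erefl isT isT hE).
Qed.

Lemma disjoint_setC (V : {set Q6}) : [disjoint V & ~: V].
Proof. by rewrite -setI_eq0 setICr. Qed.

Lemma block_conn_prob x : (x < 8)%N ->
  31 / 670 <= Ex mu (fun H => (block_conn x H)%:R).
Proof.
move=> x8.
pose E (F : (nat -> bool) -> R) := Ex mu (fun H => 1 * F (block_config x H)).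
have hE : positive_functional E by apply: Ex_functional => H; apply: ler01.
have -> : Ex mu (fun H => (block_conn x H)%:R) = E (@connF R).
  by apply: eq_Ex => H; rewrite mul1r.
suff : 31 / 670 * E (fun=> 1) <= E (@connF R).
  by rewrite /E (@eq_Ex _ _ _ _ (fun=> 1)) ?Ex_cst ?mulr1 // => H; rewrite mulr1.
apply: (thinning_bound _ cube_bound1) hE _; first lra.
move=> e e12; exists (Ex mu (fun H => (~~ block_config x H e)%:R)).
  exact/closed_prob/adj_lo.
(* Edge [e] of the block lies inside [V], and the edges far from it inside the complement, so the
   centred indicator and [phi] are independent. *)
move=> phi dphi; set r := Ex mu _; pose V := [set v : Q6 | touches e (lo v)].
have /andP[u8 v8] := ends_in_cube e.
rewrite /E (@eq_Ex _ _ _ _ (fun H =>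
  ((~~ block_config x H e)%:R - r) * phi (block_config x H))); last first.
  by move=> H; rewrite mul1r.
rewrite (Ex_indep indep (disjoint_setC V)).
- have -> : Ex mu (fun H => (~~ block_config x H e)%:R - r) = 0.
    by rewrite ExD Ex_cst subrr.
  by rewrite mul0r.
- move=> H H' HH'; rewrite /block_config (sub_adj_agree _ _ HH') //.
    by rewrite inE vtx_lo // /touches eqxx.
  by rewrite inE vtx_lo // /touches eqxx orbT.
- move=> H H' HH'; apply: dphi => i i12 /andP[iu iv].
  have /andP[? ?] := ends_in_cube i.
  by apply: (sub_adj_agree _ _ HH'); rewrite !inE vtx_lo.
Qed.

Definition block_prod (P : pred nat) H : R :=
  \prod_(x < 8 | P x) (block_conn x H)%:R.

Lemma block_prod_ge0 P H : 0 <= block_prod P H.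
Proof. by apply: prodr_ge0 => x _; apply: ler0n. Qed.

Lemma block_conn_depends (V : {set Q6}) x : (x < 8)%N ->
    (forall v, hi v = x -> v \in V) ->
  depends V (fun H => (block_conn x H)%:R : R).
Proof.
move=> x8 xV H H' HH'; rewrite /block_conn.
rewrite (@eq_in_cube_conn _ (block_config x H')) // => e _.
by apply: (sub_adj_agree _ _ HH'); apply: xV; rewrite vtx_hi.
Qed.

Lemma block_prod_depends (V : {set Q6}) (P : pred nat) :
  (forall v, P (hi v) -> v \in V) -> depends V (block_prod P).
Proof.
move=> PV.
apply: (@depends_prod _ _ V 8 P (fun x H => (block_conn x H)%:R)) => x x8 Px.
by apply: block_conn_depends => // v vx; apply: PV; rewrite vx.
Qed.

Lemma block_prod_prob (P : pred nat) :
  \prod_(x < 8) (if P x then 31 / 670 else 1) <= Ex mu (block_prod P).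
Proof.
pose f x H : R := if P x then (block_conn x H)%:R else 1.
rewrite (@eq_Ex _ _ _ _ (fun H => \prod_(x < 8) f x H)); last first.
  by move=> H; rewrite /block_prod big_mkcond.
rewrite (@Ex_prod _ _ mu hi 8 f indep) => [|x x8]; last first.
  rewrite /f; case: (P x) => [|H H' _ //].
  by apply: block_conn_depends => // v; rewrite inE => ->.
apply: ler_prod => x _; rewrite /f; case: (P x).
  by rewrite block_conn_prob // andbT; lra.
by rewrite Ex_cst ler01 lexx.
Qed.

Lemma natr_nhas (p : pred nat) s :
  (~~ has p s)%:R = \prod_(y <- s) (~~ p y)%:R :> R.
Proof.
elim: s => [|y s IHs]; first by rewrite big_nil.
by rewrite big_cons -IHs /= negb_or -natrM mulnb.
Qed.

(** A quotient edge is closed when all 8 parallel edges are; these are pairwise vertex-disjoint,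
    hence independent. *)
Lemma quotient_closed_prob e : (e < 12)%N ->
  Ex mu (fun H => (~~ quotient_config H e)%:R) <= (4153 / 10000) ^+ 8.
Proof.
move=> e12.
pose f y H : R := (~~ sub_adj H (vtx (ends e).1 y) (vtx (ends e).2 y))%:R.
rewrite (@eq_Ex _ _ _ _ (fun H => \prod_(y < 8) f y H)); last first.
  by move=> H; rewrite natr_nhas -(big_mkord predT (fun y => f y H)).
rewrite (@Ex_prod _ _ mu lo 8 f indep) => [|y y8]; last first.
  move=> H H' HH'; rewrite /f (sub_adj_agree _ _ HH') //;
  by rewrite inE vtx_lo.
have -> : (4153 / 10000) ^+ 8 = \prod_(y < 8) (4153 / 10000) :> R.
  by rewrite prodr_const card_ord.
apply: ler_prod => y _.
rewrite closed_prob ?adj_hi // andbT -[0](Ex_cst mu).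
by apply: Ex_le => H; apply: ler0n.
Qed.

Lemma touches_prod e : (e < 12)%N ->
  \prod_(x < 8) (if touches e x then 31 / 670 else 1) = (31 / 670) ^+ 2 :> R.
Proof.
rewrite !big_ord_recl big_ord0.
by do 12?[case: e => [_|e]] => //; rewrite /= !(mulr1, mul1r) -?expr2.
Qed.

Lemma quotient_conn_prob : 19 / 400 * Ex mu (block_prod predT) <=
  Ex mu (fun H => block_prod predT H * connF R (quotient_config H)).
Proof.
pose E (F : (nat -> bool) -> R) :=
  Ex mu (fun H => block_prod predT H * F (quotient_config H)).
have hE : positive_functional E.
  by apply: Ex_functional; apply: block_prod_ge0.
have -> : Ex mu (block_prod predT) = E (fun=> 1).
  by apply: eq_Ex => H; rewrite mulr1.
apply: (thinning_bound _ cube_bound2) hE _; first lra.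
move=> e e12; have /andP[u8 v8] := ends_in_cube e.
pose near_e := touches e; pose not_near_e x := ~~ touches e x.
pose closed H : R := (~~ quotient_config H e)%:R.
pose p := Ex mu (block_prod near_e).
have p_ge : (31 / 670) ^+ 2 <= p.
  by rewrite -(touches_prod e12); apply: block_prod_prob.
have p_gt0 : 0 < p by apply: lt_le_trans p_ge; rewrite exprn_gt0 //; lra.
(* The probability that [e] is closed given that the two blocks at its ends are connected. *)
pose r := Ex mu (fun H => block_prod near_e H * closed H) / p.
exists r.
  rewrite ler_pdivrMr //.
  apply: le_trans (_ : (4153 / 10000) ^+ 8 <= _).
    apply: le_trans (quotient_closed_prob e12).
    apply: Ex_le => H; rewrite ler_piMl ?ler0n // /block_prod.
    by apply: prodr_ile1 => x _; rewrite ler0n lern1 leq_b1.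
  apply: le_trans (ler_wpM2l _ p_ge); lra.
move=> phi dphi; pose V := [set v : Q6 | touches e (hi v)].
(* The first factor lives on the two blocks at the ends of [e], the second on the other six. The
   first has mean 0 by the choice of [r]. *)
rewrite /E (@eq_Ex _ _ _ _ (fun H => (block_prod near_e H * (closed H - r)) *
  (block_prod not_near_e H * phi (quotient_config H)))); last first.
  move=> H; rewrite [block_prod predT H](bigID (fun x : 'I_8 => near_e x)) /=.
  by rewrite /block_prod /closed /=; ring.
rewrite (Ex_indep indep (disjoint_setC V)).
- have -> : Ex mu (fun H => block_prod near_e H * (closed H - r)) = 0.
    rewrite (@eq_Ex _ _ _ _ (fun H => block_prod near_e H * closed H
      + - r * block_prod near_e H)); last by move=> H; ring.
    by rewrite ExD ExZ -/p mulNr /r divfK ?subrr // gt_eqF.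
  by rewrite mul0r.
- apply: depends_mul.
    by apply: block_prod_depends => v; rewrite inE.
  move=> H H' HH'; rewrite /closed /quotient_config.
  congr ((~~ _)%:R - _); apply: eq_in_has => y _.
  apply: (sub_adj_agree _ _ HH').
    by rewrite inE vtx_hi // /touches eqxx.
  by rewrite inE vtx_hi // /touches eqxx orbT.
- apply: depends_mul.
    by apply: block_prod_depends => v; rewrite !inE.
  move=> H H' HH'; apply: dphi => i i12 /andP[iu iv].
  have /andP[? ?] := ends_in_cube i.
  apply: eq_in_has => y _; apply: (sub_adj_agree _ _ HH');
  by rewrite !inE vtx_hi.
Qed.

Lemma connected_prob : (31 / 670) ^+ 8 * (19 / 400) <= Pr mu (@connected Q6).
Proof.
apply: le_trans (_ : 19 / 400 * Ex mu (block_prod predT) <= _).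
  rewrite mulrC ler_wpM2l //; first lra.
  apply: le_trans (block_prod_prob predT).
  by rewrite /= prodr_const card_ord.
apply: le_trans quotient_conn_prob _; rewrite -Ex_Pr; apply: Ex_le => H.
(* If some block is disconnected, the weight vanishes and the inequality is trivial. *)
have [blocks|] := boolP [forall x : 'I_8, block_conn x H]; last first.
  case/forallPn => x nx.
  by rewrite /block_prod (bigD1 x) //= (negbTE nx) !mul0r ler0n.
rewrite /block_prod big1 => [|x _]; last by rewrite (forallP blocks x).
rewrite mul1r ler_nat; case: (boolP (cube_conn _)) => // quotient.
rewrite blocks_connected // => x x8.
exact: (forallP blocks (Ordinal x8)).
Qed.

End CubeOfCubes.

(** * Comparison with the golden ratio *)

Theorem lemma1p8 (R : realType) :
  exists P : R,
    P > (1 - 5847 / 10000) ^+ 32 * golden_ratio R /\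
    forall mu : percolation_model R (hypercube 6),
      D_ge (5847 / 10000) mu -> P <= Pr mu (@connected (hypercube 6)).
Proof.
exists ((31 / 670) ^+ 8 * (19 / 400)); split=> [|mu]; last exact: connected_prob.
have f0 : 0 < 31 / 670 :> R by lra.
have q0 : 0 < 1 - 5847 / 10000 :> R by lra.
have golden : golden_ratio R < 16181 / 10000.
  have : Num.sqrt 5 < 22361 / 10000 :> R.
    rewrite -(@ltr_pXn2r _ 2) ?nnegrE ?sqrtr_ge0 //; last lra.
    by rewrite sqr_sqrtr; lra.
  by rewrite /golden_ratio; lra.
have r4 : (827 / 2000) ^+ 4 * (16181 / 10000) <= 19 / 400 :> R by lra.
have r0 : 0 <= 827 / 2000 * (31 / 670) ^+ 2 :> R.
  by rewrite mulr_ge0 ?exprn_ge0 ?divr_ge0 ?ler0n.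
have q8 : (1 - 5847 / 10000 : R) ^+ 8 <= 827 / 2000 * (31 / 670) ^+ 2 by lra.
have q32 : (1 - 5847 / 10000 : R) ^+ 32
    <= (827 / 2000) ^+ 4 * (31 / 670) ^+ 8.
  rewrite -[32%N]/(8 * 4)%N -[8%N in leRHS]/(2 * 4)%N !exprM -exprMn.
  by rewrite lerXn2r ?nnegrE // exprn_ge0 // ltW.
(* The strict inequality comes from rounding the golden ratio up to 1.6181. *)
apply: lt_le_trans (_ : (1 - 5847 / 10000) ^+ 32 * (16181 / 10000) <= _).
  by rewrite ltr_pM2l // exprn_gt0.
apply: le_trans (ler_wpM2r _ q32) _; first by rewrite divr_ge0 ?ler0n.
by rewrite mulrAC mulrC ler_pM2l // exprn_gt0.
Qed.
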